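(* Let $R$ be a ring such that $R_R$ is a cogenerator of the category of right $R$-modules and such that $R$ is right $R$-tight. If $R/Z(R_R)$ has completely nil Jacobson radical, then $\mathrm{Soc}(R_R)$ is finitely generated and essential in $R_R$.
   Context: All rings are associative with identity; $R_R$ denotes $R$ as a right module over itself, and $E(R_R)$ its injective envelope. A ring $R$ is right $R$-tight if every cyclic submodule of $E(R_R)$ embeds in $R_R$. $Z(R_R)$ is the right singular ideal of $R$ (elements with essential right annihilator); it is a two-sided ideal. A ring $T$ has completely nil Jacobson radical if for every two-sided ideal $N$ of $T$, every element of the Jacobson radical $J(T/N)$ is nilpotent. *)

(* Defs.v *)
From HB Require Import structures.
From mathcomp Require Import all_boot all_algebra.
From mathcomp Require Import boolp.

Set Implicit Arguments.
Unset Strict Implicit.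
Unset Printing Implicit Defensive.

Import GRing.Theory.
Local Open Scope ring_scope.
Local Open Scope quotient_scope.

(* Module-theoretic notions are stated for left modules over a ring S; right
   R-modules are the case S = R^c, the converse (opposite) ring.  Submodules
   are predicates A with submod_closed A, and a boolean predicate can be any
   subset, thanks to the classical `[< _ >]. *)

Section Modules.
Variable S : pzRingType.
Implicit Types M N C E : lmodType S.

Definition essential M (A : {pred M}) : Prop :=
  forall B : {pred M}, submod_closed B ->
    (forall x, x \in A -> x \in B -> x = 0) -> forall x, x \in B -> x = 0.

Definition simple_submod M (A : {pred M}) : Prop :=
  [/\ submod_closed A, exists2 x, x \in A & x != 0 &
      forall B : {pred M}, submod_closed B -> {subset B <= A} ->
        (forall x, x \in B -> x = 0) \/ {subset A <= B}].

Definition maximal_submod M (A : {pred M}) : Prop :=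
  [/\ submod_closed A, exists x, x \notin A &
      forall B : {pred M}, submod_closed B -> {subset A <= B} ->
        {subset B <= A} \/ (forall x, x \in B)].

(* The sum of all simple submodules. *)
Definition socle M : {pred M} := fun x =>
  `[< exists n (v : 'I_n -> M),
        (forall i, exists2 A : {pred M}, simple_submod A & v i \in A) /\
        x = \sum_(i < n) v i >].

Definition finitely_generated M (A : {pred M}) : Prop :=
  exists n (v : 'I_n -> M), forall x,
    x \in A <-> exists a : 'I_n -> S, x = \sum_(i < n) a i *: v i.

Definition cyclic_submod M (x : M) : {pred M} := fun y =>
  `[< exists a : S, y = a *: x >].

Definition image_pred M N (f : M -> N) : {pred N} := fun y =>
  `[< exists x, y = f x >].

(* A homomorphism out of the submodule A is a function on M, linear on A, whose
   values outside A are irrelevant. *)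
Definition embeds M (A : {pred M}) N : Prop :=
  exists2 f : M -> N,
    forall a, {in A &, forall u v, f (a *: u + v) = a *: f u + f v} &
    {in A &, injective f}.

Definition injective_module E : Prop :=
  forall M N (u : {linear M -> N}) (f : {linear M -> E}), injective u ->
    exists g : {linear N -> E}, g \o u =1 f.

Definition injective_envelope M E (i : {linear M -> E}) : Prop :=
  [/\ injective i, injective_module E & essential (image_pred i)].

Definition cogenerator C : Prop :=
  forall M N (f g : {linear M -> N}), ~ (f =1 g) ->
    exists h : {linear N -> C}, ~ (h \o f =1 h \o g).

Lemma essentialI M (A B : {pred M}) : submod_closed A ->
  essential A -> essential B -> essential [predI A & B].
Proof.
move=> [A0 Alin] eA eB C [C0 Clin] ABC0; apply: (eA C) => // x xA xC.
apply: (eB [predI A & C]); last by apply/andP; split.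
- split=> [|a u v /andP[uA uC] /andP[vA vC]]; apply/andP; first by split.
  by split; [exact: Alin | exact: Clin].
- by move=> y yB /andP[yA yC]; apply: ABC0 => //; apply/andP; split.
Qed.

Lemma essentialS M (A B : {pred M}) :
  {subset A <= B} -> essential A -> essential B.
Proof. by move=> sAB eA C cC BC0; apply: eA => // x /sAB; exact: BC0. Qed.

End Modules.

Arguments cogenerator {S} C.
Arguments socle {S} M.
Arguments injective_module {S} E.
Arguments embeds {S M} A N.

(* R as a right module over itself: for r : R^c and x : R, r *: x is x * r. *)
Notation right_regular R := (R^c)^o.

Definition right_tight (R : pzRingType) : Prop :=
  exists (E : lmodType R^c) (i : {linear right_regular R -> E}),
    injective_envelope i /\
    forall x : E, embeds (cyclic_submod x) (right_regular R).

Definition jacobson_radical (T : pzRingType) : {pred T} := fun x =>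
  `[< forall A : {pred right_regular T}, maximal_submod A ->
        (x : right_regular T) \in A >].
Arguments jacobson_radical : clear implicits.

HB.mixin Record isTwoSided (R : pzRingType) (I : R -> bool) := {
  two_sided_mull : forall a, {in I, forall u, a * u \in I};
  two_sided_mulr : forall a, {in I, forall u, u * a \in I}
}.

#[short(type="twoSidedIdeal")]
HB.structure Definition TwoSidedIdeal (R : pzRingType) :=
  {I of GRing.ZmodClosed R I & isTwoSided R I}.

(* ring_quotient only provides ring structures on quotients of commutative
   rings; here is the quotient of any ring by a two-sided ideal, possibly the
   whole ring. *)
Definition quot_ring (R : pzRingType) (I : twoSidedIdeal R) : Type :=
  Quotient.quot I.

Section QuotRing.
Variables (R : pzRingType) (I : twoSidedIdeal R).
Local Notation Q := (quot_ring I).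

HB.instance Definition _ := GRing.Zmodule.on Q.
HB.instance Definition _ : EqQuotient R (Quotient.equiv I) Q :=
  EqQuotient.on Q.
HB.instance Definition _ :=
  isZmodQuotient.Build R (Quotient.equiv I) 0 -%R +%R Q
    (@pi_zeror _ _ _ _ _ (Quotient.quot I))
    (@pi_oppr _ _ _ _ _ (Quotient.quot I))
    (@pi_addr _ _ _ _ _ (Quotient.quot I)).

Definition quot_one : Q := lift_cst Q 1.
Definition quot_mul := lift_op2 Q *%R.

Canonical pi_quot_one_morph := PiConst quot_one.

Lemma pi_quot_mul : {morph \pi_Q : x y / x * y >-> quot_mul x y}.
Proof.
move=> x y; unlock quot_mul; apply/eqP; rewrite piE Quotient.equivE.
rewrite -[_ * _](addrNK (x * repr (\pi_Q y))) -mulrBr -addrA -mulrBl rpredD //.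
  by rewrite two_sided_mull // Quotient.idealrDE opprK reprK.
by rewrite two_sided_mulr // Quotient.idealrDE opprK reprK.
Qed.
Canonical pi_quot_mul_morph := PiMorph2 pi_quot_mul.

Lemma quot_mulA : associative quot_mul.
Proof. by move=> x y z; rewrite -[x]reprK -[y]reprK -[z]reprK !piE mulrA. Qed.

Lemma quot_mul1l : left_id quot_one quot_mul.
Proof. by move=> x; rewrite -[x]reprK !piE mul1r. Qed.

Lemma quot_mul1r : right_id quot_one quot_mul.
Proof. by move=> x; rewrite -[x]reprK !piE mulr1. Qed.

Lemma quot_mulDl : left_distributive quot_mul +%R.
Proof.
by move=> x y z; rewrite -[x]reprK -[y]reprK -[z]reprK !piE mulrDl.
Qed.

Lemma quot_mulDr : right_distributive quot_mul +%R.
Proof.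
by move=> x y z; rewrite -[x]reprK -[y]reprK -[z]reprK !piE mulrDr.
Qed.

HB.instance Definition _ := GRing.Zmodule_isPzRing.Build Q
  quot_mulA quot_mul1l quot_mul1r quot_mulDl quot_mulDr.

End QuotRing.

Definition completely_nil_jacobson (T : pzRingType) : Prop :=
  forall (N : twoSidedIdeal T) (x : quot_ring N),
    x \in jacobson_radical (quot_ring N) -> exists n, x ^+ n = 0.

Definition right_annihilator (R : pzRingType) (z : R) :
  {pred right_regular R} := fun r => z * (r : R) == 0.

Definition right_singular (R : pzRingType) : {pred R} := fun z =>
  `[< essential (right_annihilator z) >].
Arguments right_singular : clear implicits.

Section RightSingular.
Variable R : pzRingType.
Implicit Types z a : R.

Lemma right_annihilator_submod z : submod_closed (right_annihilator z).
Proof.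
split=> [|a u v]; rewrite !unfold_in ?mulr0 // => /eqP zu /eqP zv.
by rewrite -[a *: u]/((u : R) * (a : R)) mulrDr mulrA zu zv mul0r addr0.
Qed.

Lemma right_singular_zmod : zmod_closed (right_singular R).
Proof.
split=> [|x y /asboolP ex /asboolP ey]; apply/asboolP.
  by move=> B _ B0 x xB; apply: B0; rewrite // unfold_in mul0r.
apply: essentialS (essentialI (right_annihilator_submod x) ex ey) => r.
rewrite inE => /andP[/eqP xr /eqP yr].
by rewrite unfold_in mulrBl xr yr subrr.
Qed.

Lemma right_singular_mull a :
  {in right_singular R, forall z, a * z \in right_singular R}.
Proof.
move=> z /asboolP ez; apply/asboolP; apply: essentialS ez => r /eqP zr.
by rewrite unfold_in -mulrA zr mulr0.
Qed.

Lemma right_singular_mulr a :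
  {in right_singular R, forall z, z * a \in right_singular R}.
Proof.
move=> z /asboolP ez; apply/asboolP => B [B0 Blin] zaB0.
pose aB : {pred right_regular R} :=
  fun y => `[< exists2 b : R, (b : right_regular R) \in B & y = a * b >].
have aB0 y : y \in aB -> y = 0.
  apply: ez => [|{}y /eqP zy /asboolP[b bB yE]].
    split=> [|c u v /asboolP[b bB ->] /asboolP[d dB ->]]; apply/asboolP.
      by exists 0; rewrite ?mulr0.
    exists (b * (c : R) + d); first exact: (Blin c b d).
    by rewrite mulrDr mulrA.
  rewrite yE (zaB0 b) ?mulr0 // unfold_in.
  by rewrite -mulrA -yE zy.
move=> b bB; apply: zaB0 => //; rewrite unfold_in -mulrA.
by rewrite (aB0 (a * (b : R))) ?mulr0 //; apply/asboolP; exists b.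
Qed.

HB.instance Definition _ :=
  GRing.isZmodClosed.Build R (right_singular R) right_singular_zmod.
HB.instance Definition _ := isTwoSided.Build R (right_singular R)
  right_singular_mull right_singular_mulr.

End RightSingular.

(* Main.v *)
Require Import Defs.
From HB Require Import structures.
From mathcomp Require Import all_boot all_algebra.
From mathcomp Require Import boolp classical_sets functions wochoice cardinality.

(* Write c ~ d when the simple right ideals c R and d R are isomorphic, and let
   the support of r in R be the set of types of the simple right ideals which
   r does not kill.  Every set A of types is the support of some r, which
   moreover maps each simple right ideal of type in A to one of the same type:
   the projection of Soc(R) onto its A-part extends to R -> E(R), and the image
   of 1 generates a cyclic module, which embeds in R.  If I is an ideal of sets
   of types with A not in I, then r is not nilpotent modulo the ideal N_I of the
   elements with support in I, so the hypothesis on J gives a simple module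
   killed by N_I but not by r; as R is a cogenerator, it is one of the types.
   If there are infinitely many types, a diagonal argument yields an I for which
   this requires more types than there are.
   So there are finitely many types.  The injective hull of a simple right ideal
   c R is a direct summand e R of R with simple socle and simple top, and the
   top determines the type of c.  By finiteness every simple module is such a
   top, whence 1 is a sum of elements of the R e R.  Thus R embeds in a finite
   direct sum of modules e R, whose socles are simple and essential. *)

Set Implicit Arguments.
Unset Strict Implicit.
Unset Printing Implicit Defensive.

Import GRing.Theory.

(** * Ideals of subsets of an infinite set *)

Section SetTheory.
Local Open Scope classical_set_scope.

(** Zorn's lemma is applied to the sets whose union with A0 satisfies P; the empty chain is then
    handled by [P A0]. *)
Lemma Zorn_above T (P : set (set T)) (A0 : set T) : P A0 ->
  (forall F : set (set T), F !=set0 -> F `<=` P -> total_on F subset ->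
    P (\bigcup_(A in F) A)) ->
  exists A, [/\ A0 `<=` A, P A & forall B, A `<=` B -> P B -> B `<=` A].
Proof.
move=> PA0 Pchain.
have [|A [PA maxA]] := @Zorn_bigcup T [set A | P (A0 `|` A)].
  move=> F FP Ftot; have [->|/set0P[A1 FA1]] := eqVneq F set0.
    by rewrite /= bigcup_set0 setU0.
  rewrite /= (_ : _ `|` _ = \bigcup_(A in [set A0 `|` B | B in F]) A).
    apply: Pchain => [|_ [B FB <-]|_ _ [B FB <-] [C FC <-]].
    - by exists (A0 `|` A1), A1.
    - exact: FP.
    - by case: (Ftot B C FB FC) => ?; [left|right]; exact: setUS.
  apply/seteqP; split => [x [A0x|[B FB Bx]]|x [_ [B FB <-] [A0x|Bx]]].
  - by exists (A0 `|` A1); [exists A1|left].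
  - by exists (A0 `|` B); [exists B|right].
  - by left.
  - by right; exists B.
exists (A0 `|` A); split=> // B AB PB x Bx; apply: contrapT => nAx.
apply: (maxA B); first split.
- by move=> y Ay; apply: AB; right.
- by move/(_ x Bx) => Ax; apply: nAx; right.
- by rewrite /= setUidr // => y A0y; apply: AB; left.
Qed.

(** A maximal graph of a partial injection is total or onto: points missed on both sides would give
    a pair to add. *)
Lemma injection_total (T U : Type) :
  (exists f : T -> U, injective f) \/ (exists g : U -> T, injective g).
Proof.
pose P (F : set (T * U)) :=
  forall p q, F p -> F q -> (p.1 = q.1) <-> (p.2 = q.2).
have [|F [PF maxF]] := @Zorn_bigcup (T * U)%type P.
  move=> F FP Ftot p q [A FA Ap] [B FB Bq].
  by case: (Ftot A B FA FB) => sAB; [apply: (FP B)|apply: (FP A)] => //; exact: sAB.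
have [domF|/existsNP[a aF]] := pselect (forall a, exists b, F (a, b)).
  have [f fF] := choice domF; left; exists f => a b fab.
  by apply/(PF _ _ (fF a) (fF b)).
right; have rngF b : exists a, F (a, b).
  apply: contrapT => bF; apply: (maxF (F `|` [set (a, b)])).
    split; first by move=> x; left.
    by move/(_ (a, b)) => /(_ (or_intror erefl)) Fab; apply: bF; exists a.
  move=> p q [Fp|->] [Fq|->] //=; first exact: PF.
  - split=> E; first by case: aF; exists p.2; rewrite -E -surjective_pairing.
    by case: bF; exists p.1; rewrite -E -surjective_pairing.
  - split=> E; first by case: aF; exists q.2; rewrite E -surjective_pairing.
    by case: bF; exists q.1; rewrite E -surjective_pairing.
have [g gF] := choice rngF; exists g => b c gbc.
by apply/(PF _ _ (gF b) (gF c)).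
Qed.

(* Hessenberg's theorem, by Zorn's lemma on the injections X * X -> X, with
   X a subset of T: these are coded by their graphs F, and X = [sq_dom F]. *)
Definition sq_dom T (F : set (T * T * T)) : set T :=
  [set x | exists z, F (x, x, z)].

Definition sq_inj T (F : set (T * T * T)) : Prop :=
  [/\ forall p q, F p -> F q -> (p.1 = q.1) <-> (p.2 = q.2),
      forall x y, sq_dom F x -> sq_dom F y -> exists z, F (x, y, z) &
      forall x y z, F (x, y, z) -> [/\ sq_dom F x, sq_dom F y & sq_dom F z]].

Lemma sq_dom_sub T (F G : set (T * T * T)) :
  F `<=` G -> sq_dom F `<=` sq_dom G.
Proof. by move=> FG x [z /FG]; exists z. Qed.

Lemma sq_inj_bigcup T (F : set (set (T * T * T))) :
  F `<=` @sq_inj T -> total_on F subset -> sq_inj (\bigcup_(A in F) A).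
Proof.
move=> FP Ftot.
have dom A : F A -> sq_dom A `<=` sq_dom (\bigcup_(A in F) A).
  by move=> FA; apply: sq_dom_sub => x Ax; exists A.
split=> [p q [A FA Ap] [B FB Bq]|x y [z [A FA Az]] [t [B FB Bt]]|x y z [A FA Az]].
- have [sAB|sBA] := Ftot A B FA FB.
    by have [h _ _] := FP B FB; apply: h => //; exact: sAB.
  by have [h _ _] := FP A FA; apply: h => //; exact: sBA.
- have [sAB|sBA] := Ftot A B FA FB.
    have [_ h _] := FP B FB; have [||u ?] := h x y; [|by exists t|].
      by exists z; exact: sAB.
    by exists u; exists B.
  have [_ h _] := FP A FA; have [||u ?] := h x y; [by exists z| |].
    by exists t; exact: sBA.
  by exists u; exists A.
- by have [_ _ h] := FP A FA; have [? ? ?] := h _ _ _ Az; split; exact: (dom A).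
Qed.

(** Besides X * X, the square of the union of X and j(X) has three blocks. All are sent into j(X),
    hence off the values of F, and the tag [u b c] keeps the blocks apart. *)
Lemma sq_inj_extend T (F : set (T * T * T)) (j : T -> T) (u : bool -> bool -> T) :
  sq_inj F -> (forall x, sq_dom F x -> ~ sq_dom F (j x)) ->
  {in sq_dom F &, injective j} ->
  (forall b c, sq_dom F (u b c)) ->
  (forall b c b' c', u b c = u b' c' -> b = b' /\ c = c') ->
  exists G, [/\ F `<=` G, sq_inj G & forall x, sq_dom F x -> sq_dom G (j x)].
Proof.
move=> [Finj Fdom Frng] jX jinj uX uinj; set X := sq_dom F in jX jinj uX *.
have {jinj} jinj x y : X x -> X y -> j x = j y -> x = y.
  by move=> Xx Xy; apply: jinj; rewrite inE.
have [e eF] : exists e : T * T -> T, forall x y, X x -> X y -> F (x, y, e (x, y)).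
  have [|e eF] := @choice (T * T) T (fun p z => X p.1 -> X p.2 -> F (p, z)).
    move=> [x y]; have [[Xx Xy]|nX] := pselect (X x /\ X y).
      by have [z ?] := Fdom x y Xx Xy; exists z.
    by exists x => /= Xx Xy; case: nX.
  by exists e => x y; exact: (eF (x, y)).
have eX x y : X x -> X y -> X (e (x, y)).
  by move=> Xx Xy; have [] := Frng _ _ _ (eF _ _ Xx Xy).
have einj x y x' y' : X x -> X y -> X x' -> X y' ->
    e (x, y) = e (x', y') -> x = x' /\ y = y'.
  move=> Xx Xy Xx' Xy' eE.
  by have /= [_ /(_ eE)[-> ->]] := Finj _ _ (eF _ _ Xx Xy) (eF _ _ Xx' Xy').
pose k (b : bool) x := if b then j x else x.
have kinj b x b' x' : X x -> X x' -> k b x = k b' x' -> b = b' /\ x = x'.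
  case: b b' => -[] Xx Xx' //= E.
  - by split=> //; exact: jinj.
  - by case: (jX x) => //; rewrite E.
  - by case: (jX x') => //; rewrite -E.
pose w b c x y := j (e (u b c, e (x, y))).
pose G : set (T * T * T) := fun p => F p \/ exists b c x y,
  [/\ b || c, X x, X y & p = (k b x, k c y, w b c x y)].
have FG : F `<=` G by move=> p Fp; left.
have GX x : X x -> sq_dom G x by apply: sq_dom_sub.
have Gj x : X x -> sq_dom G (j x).
  by move=> Xx; exists (w true true x x); right; exists true, true, x, x.
have Gk b x : X x -> sq_dom G (k b x) by case: b; [exact: Gj|exact: GX].
have GX' x : sq_dom G x -> exists b y, X y /\ x = k b y.
  move=> [z [Fz|[b [c [y [y' [_ Xy Xy' [-> _ _]]]]]]]].
    by exists false, x; have [] := Frng _ _ _ Fz.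
  by exists b, y.
have mix p b c x y : F p -> b || c -> X x -> X y ->
    p.1 <> (k b x, k c y) /\ p.2 <> w b c x y.
  case: p => -[x' y'] z Fp bc Xx Xy; have [Xx' Xy' Xz] := Frng _ _ _ Fp.
  split=> /= [[E1 E2]|E].
    case/orP: bc => b1; first by case: (jX x); rewrite // -[j x]/(k true x) -b1 -E1.
    by case: (jX y); rewrite // -[j y]/(k true y) -b1 -E2.
  by case: (jX _ (eX _ _ (uX b c) (eX _ _ Xx Xy))); rewrite -/(w b c x y) -E.
exists G; split=> //; split.
- move=> p q [Fp|[b [c [x [y [bc Xx Xy ->]]]]]]
             [Fq|[b' [c' [x' [y' [bc' Xx' Xy' ->]]]]]] /=.
  + exact: Finj.
  + by have [? ?] := mix p b' c' x' y' Fp bc' Xx' Xy'; split.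
  + by have [h1 h2] := mix q b c x y Fq bc Xx Xy; split=> E; [case: h1|case: h2].
  + split=> [[E1 E2]|E0].
      by have [-> ->] := kinj _ _ _ _ Xx Xx' E1;
      have [-> ->] := kinj _ _ _ _ Xy Xy' E2.
    have E := jinj _ _ _ _ E0.
    have [uE eE] := einj _ _ _ _ (uX b c) (eX _ _ Xx Xy) (uX b' c')
      (eX _ _ Xx' Xy') (E (eX _ _ (uX b c) (eX _ _ Xx Xy))
                          (eX _ _ (uX b' c') (eX _ _ Xx' Xy'))).
    by have [-> ->] := uinj _ _ _ _ uE;
      have [-> ->] := einj _ _ _ _ Xx Xy Xx' Xy' eE.
- move=> x y /GX'[b [x' [Xx' ->]]] /GX'[c [y' [Xy' ->]]].
  have [bc|] := boolP (b || c).
    by exists (w b c x' y'); right; exists b, c, x', y'.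
  rewrite negb_or => /andP[/negPf -> /negPf ->].
  by exists (e (x', y')); left; exact: eF.
- move=> x y z [Fz|[b [c [x' [y' [bc Xx' Xy' [-> -> ->]]]]]]].
    by have [? ? ?] := Frng _ _ _ Fz; split; exact: GX.
  by split; try exact: Gk; apply: Gj; apply: (eX) => //; exact: eX.
Qed.

Lemma sval_inj T (P : T -> Prop) : injective (@sval T P).
Proof.
by move=> x y; apply: eq_sig_hprop => z p q; exact: Prop_irrelevance.
Qed.

Lemma Hessenberg T (n : nat -> T) : injective n ->
  exists e : T * T -> T, injective e.
Proof.
move=> ninj.
pose F0 : set (T * T * T) := fun p =>
  exists a b : nat, p = (n a, n b, n (choice.pickle (a, b))).
have F0n a : sq_dom F0 (n a) by exists (n (choice.pickle (a, a))), a, a.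
have [|F _ FP Ftot|F [F0F PF maxF]] := @Zorn_above _ (@sq_inj T) F0.
- split=> [_ _ [a [b ->]] [c [d ->]]|_ _ [_ [a [_ [-> _ _]]]] [_ [b [_ [-> _ _]]]]|].
  + split=> /= [[/ninj-> /ninj->]//|/ninj h].
    by have [-> ->] := pcan_inj choice.pickleK h.
  + by exists (n (choice.pickle (a, b))), a, b.
  + by move=> _ _ _ [a [b [-> -> ->]]].
- exact: sq_inj_bigcup.
have Xn a : sq_dom F (n a) by apply: sq_dom_sub F0F _ _.
have [Finj Fdom Frng] := PF.
(* If X injects into its complement, then F extends, against maximality. Otherwise T itself injects
   into X. *)
have [[j jinj]|[j jinj]] :=
  injection_total {x | sq_dom F x} {x | ~ sq_dom F x}.
  pose J x := if pselect (sq_dom F x) is left h then sval (j (exist _ x h)) else x.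
  have JE x (h : sq_dom F x) : J x = sval (j (exist _ x h)).
    by rewrite /J; case: pselect => // h'; rewrite (Prop_irrelevance h h').
  have [||b c|b c b' c' /ninj /(pcan_inj choice.pickleK)[]|G [FG PG GJ]] :=
    @sq_inj_extend _ F J (fun b c => n (choice.pickle (b, c))) PF _ _ _ _ => //.
  - by move=> x Fx; rewrite (JE x Fx); case: (j _).
  - move=> x y; rewrite !inE => Fx Fy; rewrite (JE x Fx) (JE y Fy) => /sval_inj.
    by move=> /jinj [].
  - have [] : ~ sq_dom F (J (n 0)) by rewrite (JE _ (Xn 0)); case: (j _).
    exact: sq_dom_sub (maxF G FG PG) _ (GJ _ (Xn 0)).
have [|e eF] := @choice (T * T) T
    (fun p z => sq_dom F p.1 -> sq_dom F p.2 -> F (p, z)).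
  move=> [x y]; have [[Xx Xy]|nX] := pselect (sq_dom F x /\ sq_dom F y).
    by have [z ?] := Fdom x y Xx Xy; exists z.
  by exists x => /= Xx Xy; case: nX.
have {}eF x y : sq_dom F x -> sq_dom F y -> F (x, y, e (x, y)).
  exact: (eF (x, y)).
have eX x y : sq_dom F x -> sq_dom F y -> sq_dom F (e (x, y)).
  by move=> Xx Xy; have [] := Frng _ _ _ (eF _ _ Xx Xy).
have einj x y x' y' : sq_dom F x -> sq_dom F y -> sq_dom F x' -> sq_dom F y' ->
    e (x, y) = e (x', y') -> x = x' /\ y = y'.
  move=> Xx Xy Xx' Xy' eE.
  by have /= [_ /(_ eE)[-> ->]] := Finj _ _ (eF _ _ Xx Xy) (eF _ _ Xx' Xy').
(* The tags [n 0] and [n 1] separate the points of X from the others. *)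
pose g x := if pselect (sq_dom F x) is right h then e (n 1, sval (j (exist _ x h)))
            else e (n 0, x).
have gX x : sq_dom F (g x).
  by rewrite /g; case: pselect => h; apply: eX => //; case: (j _).
have ginj : injective g.
  move=> x y; rewrite /g; case: pselect => hx; case: pselect => hy.
  - by move/einj => [].
  - by move/einj => [] //; [case: (j _)|move/ninj].
  - by move/einj => [] //; [case: (j _)|move/ninj].
  - move/einj => [] //; try by case: (j _).
    by move=> _ /sval_inj /jinj [].
exists (fun p => e (g p.1, g p.2)) => -[x y] [x' y'] /= /einj[] //.
by move=> /ginj-> /ginj->.
Qed.

(* The members of I are the sets bounded in the first coordinate, for a
   well-ordered X and a pairing of X and T in T; those outside I include the
   graphs of the functions X -> T.  A function f which differs from the f_i,
   for i <= x, at each x has a graph which meets each graph f_i in I. *)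
Lemma ideal_diagonal (T : choiceType) : infinite_set [set: T] ->
  exists I : set (set T),
    [/\ I set0, forall A B, A `<=` B -> I B -> I A,
        forall A B, I A -> I B -> I (A `|` B) &
        forall G : T -> set T -> Prop, (forall A, ~ I A -> exists c, G c A) ->
          exists c A B, [/\ G c A, G c B & I (A `&` B)]].
Proof.
move=> Tinf.
have [n ninj] : exists n : nat -> T, injective n.
  have /infiniteP/card_leP/unsquash f := Tinf.
  exists (fun k => val (f (SigSub (in_setT k)))) => k l /val_inj/inj.
  by rewrite !inE => /(_ I I)[].
have [e einj] := Hessenberg ninj.
have [R Rwo] := well_ordering_principle T.
have Rch : wo_chain R predT by exact: withinW.
have Rtot x y : R x y || R y x by exact: (wo_chainW Rch).
have Rxx x : R x x by exact: (wo_chain_reflexive Rch).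
have Ranti x y : R x y -> R y x -> x = y.
  by move=> Rxy Ryx; apply: (wo_chain_antisymmetric Rch) => //; rewrite Rxy.
have Rmin (A : set T) : A !=set0 -> exists2 z, A z & forall y, A y -> R z y.
  move=> [x Ax]; have [|z [[zA zmin] _]] := Rwo [pred x | `[< A x >]].
    by exists x; apply/asboolP.
  by exists z => [|y Ay]; [exact/asboolP|apply: zmin; exact/asboolP].
have Rtrans x y z : R x y -> R y z -> R x z.
  have [|t] := Rmin [set u | u = x \/ u = y \/ u = z]; first by exists x; left.
  move=> [->|[->|->]] tmin Rxy Ryz.
  - by apply: tmin; right; right.
  - by rewrite (Ranti x y) //; apply: tmin; left.
  - by rewrite -(Ranti y z) //; apply: tmin; right; left.
pose onto (A : set T) := exists g : T -> T, forall y, exists2 x, A x & g x = y.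
(* X is an initial segment of least length among those that have the cardinality of T. *)
have [X [[x0 Xx0] Xonto Xseg]] : exists X : set T, [/\ X !=set0, onto X &
    forall x, X x -> ~ onto [set y | X y /\ R y x]].
  have [[x1 x1P]|nseg] := pselect (exists x, onto [set y | R y x]); last first.
    exists setT; split; [by exists (n 0) | by exists id => y; exists y|].
    move=> x _ [g gP]; apply: nseg; exists x, g => y.
    by have [z [_ ?]] := gP y; exists z.
  have [|x [g gP] xmin] := Rmin [set x | onto [set y | R y x]]; first by exists x1.
  pose X := [set y | R y x /\ y <> x].
  have Xonto : onto X.
    have [h hP] : exists h : T -> T * T, forall z, h (e z) = z.
      pose h y := if pselect (exists z, e z = y) is left p then sval (cid p)
                  else (x, x).
      exists h => z; rewrite /h; case: pselect => [p|]; last by case; exists z.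
      by apply: einj; case: (cid p).
    (* Removing x loses one value of [g]. The values [e (n k, y)], with k chosen so that none of
       them is [g x], are still taken and cover T through the second coordinate. *)
    have [k kx] : exists k, n k <> (h (g x)).1.
      have [n0|] := pselect (n 0 = (h (g x)).1); last by exists 0.
      by exists 1; rewrite -n0 => /ninj.
    exists (fun y => (h (g y)).2) => y; have [z Rzx gz] := gP (e (n k, y)).
    exists z; last by rewrite gz hP.
    by split=> // zx; apply: kx; rewrite -zx gz hP.
  exists X; split=> //.
    by have [g' gX] := Xonto; have [z Xz _] := gX x; exists z.
  move=> z [Rzx zx] [g' gX]; apply: zx; apply: Ranti => //; apply: xmin.
  by exists g' => y; have [t [_ ?]] := gX y; exists t.
pose bounded (S : set T) z := forall x y, X x -> S (e (x, y)) -> R x z /\ x <> z.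
pose graph (f : T -> T) := [set e (x, f x) | x in X].
exists [set S | exists2 z, X z & bounded S z]; split.
- by exists x0.
- by move=> A B AB [z Xz bB]; exists z => // x y Xx /AB; exact: bB.
- move=> A B [z Xz bA] [t Xt bB].
  wlog Rzt : A B z Xz bA t Xt bB / R z t.
    by have /orP[h|h] := Rtot z t => H; [|rewrite setUC]; apply: H h.
  exists t => // x y Xx [/bA[]//|/bB]; last exact.
  move=> Rxz xz; split=> [|xt]; first exact: Rtrans Rzt.
  by apply: xz; apply: Ranti => //; rewrite xt.
move=> G Gcov.
have [s sP] := Xonto.
(* [s] indexes T by X, and [f i] is some function whose graph is related to [s i], if there is
   one. *)
have [i|f fP] := @choice T (T -> T) (fun i f => forall g, G (s i) (graph g) ->
    G (s i) (graph f)).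
  have [[f fG]|nG] := pselect (exists f, G (s i) (graph f)); first by exists f.
  by exists id => g Gg; case: nG; exists g.
have [x|g gP] := @choice T T (fun x y =>
    forall i, X x -> X i -> R i x -> f i x <> y).
  have [Xx|] := pselect (X x); last by exists x.
  (* Were no value free, mapping i to [f i x] would send the segment of the i up to x onto T. *)
  apply: contrapT => ng; apply: (Xseg x Xx); exists (fun i => f i x) => y.
  apply: contrapT => ny; apply: ng; exists y => i _ Xi Rix fix_.
  by apply: ny; exists i.
have [|c Gg] := Gcov (graph g).
  move=> [z Xz bz]; have [||_ ] := bz z (g z) => //.
  by exists z.
have [i Xi sic] := sP c.
exists c, (graph g), (graph (f i)); split=> //.
  by rewrite -sic; apply: (fP i g); rewrite sic.
exists i => // x y Xx [[x' Xx' /einj[-> gy]] [x'' Xx'' /einj[xx fy]]].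
subst x''; have nRix : ~ R i x by by move=> h; case: (gP x i Xx Xi h); rewrite fy.
have /orP[Rxi|/nRix//] := Rtot x i; split=> // xi.
by apply: nRix; rewrite xi.
Qed.

End SetTheory.

Local Open Scope ring_scope.

(** * Submodules, quotients and injective modules *)

Section Submodule.
Variables (S : pzRingType) (M : lmodType S) (A : {pred M}).
Hypothesis cA : submod_closed A.

(** The proof [cA] is made a parameter, so that the submodule structure can be inferred from the
    term [submod_pred cA]. *)
Definition submod_pred : {pred M} := let _ := cA in A.

HB.instance Definition _ := GRing.isSubmodClosed.Build S M submod_pred cA.

Record submod_type := SubmodElt {
  submod_val : M; submod_valP : submod_val \in submod_pred }.

HB.instance Definition _ := [isSub for submod_val].
HB.instance Definition _ := [Choice of submod_type by <:].
HB.instance Definition _ := [SubChoice_isSubLmodule of submod_type by <:].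

End Submodule.

Section Quotient.
Local Open Scope quotient_scope.
Variables (S : pzRingType) (M : lmodType S) (A : {pred M}).
Hypothesis cA : submod_closed A.

Local Notation I := (submod_pred cA).
Definition quot_mod : Type := Quotient.quot I.
Local Notation Q := quot_mod.

HB.instance Definition _ := GRing.Zmodule.on Q.
HB.instance Definition _ : EqQuotient M (Quotient.equiv I) Q := EqQuotient.on Q.
HB.instance Definition _ :=
  isZmodQuotient.Build M (Quotient.equiv I) 0 -%R +%R Q
    (@pi_zeror _ _ _ _ _ (Quotient.quot I))
    (@pi_oppr _ _ _ _ _ (Quotient.quot I))
    (@pi_addr _ _ _ _ _ (Quotient.quot I)).

Definition quot_scale (a : S) : Q -> Q := lift_op1 Q ( *:%R a).

Lemma pi_quot_scale a : {morph \pi_Q : x / a *: x >-> quot_scale a x}.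
Proof.
move=> x; unlock quot_scale; apply/eqP; rewrite piE Quotient.equivE.
by rewrite -scalerBr rpredZ // Quotient.idealrDE opprK reprK.
Qed.
Canonical pi_quot_scale_morph a := PiMorph1 (pi_quot_scale a).

Lemma quot_scaleA a b x : quot_scale a (quot_scale b x) = quot_scale (a * b) x.
Proof. by rewrite -[x]reprK !piE scalerA. Qed.

Lemma quot_scale1 : left_id 1 quot_scale.
Proof. by move=> x; rewrite -[x]reprK !piE scale1r. Qed.

Lemma quot_scaleDr : right_distributive quot_scale +%R.
Proof. by move=> a x y; rewrite -[x]reprK -[y]reprK !piE scalerDr. Qed.

Lemma quot_scaleDl x : {morph quot_scale^~ x : a b / a + b}.
Proof. by move=> a b; rewrite -[x]reprK !piE scalerDl. Qed.

HB.instance Definition _ := GRing.Zmodule_isLmodule.Build S Q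
  quot_scaleA quot_scale1 quot_scaleDr quot_scaleDl.

Definition quot_pi (x : M) : Q := \pi_Q x.

Lemma quot_pi_linear : linear quot_pi.
Proof. by move=> a x y; rewrite /quot_pi !piE. Qed.

HB.instance Definition _ := GRing.isLinear.Build S M Q _ quot_pi quot_pi_linear.

Lemma quot_pi_eq0 x : (quot_pi x == 0) = (x \in A).
Proof. by rewrite /quot_pi piE Quotient.equivE subr0. Qed.

End Quotient.

(** There are three uses: D holds of 1 only for maximal right ideals, of c only for a complement of
    the module generated by c, and of the nonzero elements of W for a complement of W. The last
    clause expresses maximality. *)
Lemma max_submod_avoiding (S : pzRingType) (M : lmodType S) (B : {pred M})
    (D : M -> Prop) : submod_closed B -> (forall x, x \in B -> ~ D x) ->
  exists A : {pred M}, [/\ submod_closed A, {subset B <= A},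
    forall x, x \in A -> ~ D x &
    forall x, x \notin A -> exists2 y, y \in A & exists a, D (y + a *: x)].
Proof.
move=> [B0 Blin] BD.
pose P (A : set M) := [/\ A 0, forall a x y, A x -> A y -> A (a *: x + y) &
  forall x, A x -> ~ D x].
have [|F [A0 FA0] FP Ftot|A [BA [PA0 Alin AD] maxA]] :=
  @Zorn_above M P [set x | x \in B]%classic.
- by split=> //; exact: Blin.
- split=> [|a x y [A FA Ax] [A' FA' A'y]|x [A FA Ax]].
  + by exists A0 => //; have [] := FP _ FA0.
  + have [sAA'|sAA'] := Ftot A A' FA FA'.
      by exists A' => //; have [_ h _] := FP _ FA'; apply: h => //; exact: sAA'.
    by exists A => //; have [_ h _] := FP _ FA; apply: h => //; exact: sAA'.
  + by have [_ _ h] := FP A FA; exact: h.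
exists (fun x => `[< A x >]); split.
- by split=> [|a x y /asboolP Ax /asboolP Ay]; apply/asboolP; [|exact: Alin].
- by move=> x /BA Ax; apply/asboolP.
- by move=> x /asboolP; exact: AD.
move=> x /asboolP nAx; apply: contrapT => nD; apply: nAx.
pose A' := [set z | exists2 y, A y & exists a, z = y + a *: x]%classic.
apply: (maxA A'); last by exists 0 => //; exists 1; rewrite scale1r add0r.
  by move=> y Ay; exists y => //; exists 0; rewrite scale0r addr0.
split=> [|a _ _ [y Ay [b ->]] [z Az [c ->]]|_ [y Ay [b ->]] Dz].
- by exists 0 => //; exists 0; rewrite scale0r addr0.
- exists (a *: y + z); first exact: Alin.
  by exists (a * b + c); rewrite scalerDr scalerA scalerDl addrACA.
- by apply: nD; exists y; [exact/asboolP|exists b].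
Qed.

Lemma cyclic_submod_closed (S : pzRingType) (M : lmodType S) (x : M) :
  submod_closed (cyclic_submod x).
Proof.
split=> [|a y z /asboolP[b ->] /asboolP[d ->]]; apply/asboolP.
  by exists 0; rewrite scale0r.
by exists (a * b + d); rewrite scalerDl scalerA.
Qed.

Section Extension.
Variables (S : pzRingType) (E : lmodType S).
Hypothesis injE : injective_module E.

(** G is the graph of a homomorphism on a submodule of N. The first projection is injective on this
    graph, and the second projection is extended along it. *)
Lemma linear_rel_extension (N : lmodType S) (G : N -> E -> Prop) :
  G 0 0 -> (forall a x y x' y', G x y -> G x' y' -> G (a *: x + x') (a *: y + y')) ->
  (forall y, G 0 y -> y = 0) ->
  exists g : {linear N -> E}, forall x y, G x y -> g x = y.
Proof.
move=> G0 Glin Gfun.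
pose A : {pred N * E} := fun p => `[< G p.1 p.2 >].
have cA : submod_closed A.
  split=> [|a p q /asboolP Gp /asboolP Gq]; apply/asboolP; first exact: G0.
  exact: Glin.
pose T := submod_type cA.
pose u : {linear T -> N} := fst \o (val : T -> (N * E)%type).
pose f : {linear T -> E} := snd \o (val : T -> (N * E)%type).
have uinj : injective u.
  apply: raddf_inj => -[[x y] xyA] /= x0; apply: val_inj => /=.
  by move: (xyA); rewrite /u /= in x0 *; rewrite x0 => /asboolP/Gfun /= ->.
have [g gE] := injE f uinj.
exists g => x y Gxy; have Axy : (x, y) \in submod_pred cA by apply/asboolP.
exact: gE (SubmodElt Axy).
Qed.

Lemma linear_extension (N M : lmodType S) (u : {linear N -> M})
    (f : {linear N -> E}) : injective u ->
  exists g : {linear M -> E}, forall x, g (u x) = f x.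
Proof. by move=> uinj; have [g gE] := injE f uinj; exists g. Qed.

Lemma linear_projection (N : lmodType S) (A B : {pred N}) (f : {linear N -> E}) :
  submod_closed A -> submod_closed B ->
  (forall x, x \in A -> x \in B -> x = 0) ->
  exists g : {linear N -> E},
    {in A, forall x, g x = f x} /\ {in B, forall x, g x = 0}.
Proof.
move=> [A0 Alin] [B0 Blin] AB0.
have [|||g gE] := @linear_rel_extension N (fun x y =>
    exists a b, [/\ a \in A, b \in B, x = a + b & y = f a]).
- by exists 0, 0; rewrite addr0 linear0.
- move=> c ? ? ? ? [a [b [aA bB -> ->]]] [a' [b' [aA' bB' -> ->]]].
  exists (c *: a + a'), (c *: b + b'); split; [exact: Alin|exact: Blin| |].
    by rewrite scalerDr addrACA.
  by rewrite linearP.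
- move=> ? [a [b [aA bB /esym/eqP]]]; rewrite addr_eq0 => /eqP ab ->.
  rewrite (AB0 a) ?linear0 // ab -[- b]addr0 -scaleN1r; exact: Blin.
exists g; split=> x xAB; apply: gE.
  by exists x, 0; rewrite addr0.
by exists 0, x; rewrite add0r linear0.
Qed.

(* With W a complement of the submodule C generated by c, and V a complement of
   W containing C, the projection onto V along W makes V an injective hull of C. *)
Lemma simple_hull_projection (c : E) : c != 0 ->
  (forall a, a *: c != 0 -> exists b, b *: (a *: c) = c) ->
  exists p : {linear E -> E}, [/\ forall x, p (p x) = p x, p c = c &
    forall x, p x != 0 -> exists a, a *: p x = c].
Proof.
move=> c0 csimple.
have cyc := cyclic_submod_closed c.
have cC : c \in cyclic_submod c by apply/asboolP; exists 1; rewrite scale1r.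
have [||W [cW _ Wc Wmax]] :=
  @max_submod_avoiding S E (pred1 0) (fun x => x = c).
- by split=> [|a x y /eqP-> /eqP->]; rewrite !inE ?scaler0 ?addr0.
- by move=> x /eqP-> /esym/eqP; apply/negP.
have [W0 Wlin] := cW.
have WC x : x \in cyclic_submod c -> x \in W -> x = 0.
  move=> /asboolP[a ->] aW; apply: contrapT => /eqP/csimple[b bc].
  by apply: (Wc _ _ bc); rewrite -[b *: _]addr0; exact: Wlin.
have Wker (g : {linear E -> E}) : g c = c -> {in W, forall x, g x = 0} ->
    forall x, g x != 0 -> exists a, a *: g x = c.
  move=> gc gW x gx0.
  have [|y yW [a yxc]] := Wmax x; first by apply/negP => /gW/eqP; apply/negP.
  by exists a; rewrite -gc -yxc linearD (gW y) // add0r linearZ.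
have [g [gC gW]] := linear_projection (idfun : {linear E -> E}) cyc cW WC.
have gc : g c = c by rewrite gC.
have [|V [cV CV VW Vmax]] :=
  @max_submod_avoiding S E (cyclic_submod c) (fun x => x \in W /\ x <> 0) cyc.
  by move=> x xC [xW x0]; apply: x0; exact: WC.
have [V0 Vlin] := cV.
have gVinj x : x \in V -> g x = 0 -> x = 0.
  move=> xV gx; apply: contrapT => x0; apply: (VW x) => //; split=> //.
  apply: contrapT => /negP/Wmax[y yW [a yxc]]; case/eqP: c0.
  by rewrite -gc -yxc linearD (gW y) // linearZ gx /= scaler0 addr0.
have [|||k kP] := @linear_rel_extension E (fun x y => y \in V /\ x = g y).
- by rewrite linear0.
- move=> a x y x' y' [yV ->] [y'V ->]; split; first exact: Vlin.
  by rewrite linearP.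
- by move=> y [yV /esym gy]; exact: gVinj.
pose p : {linear E -> E} := k \o g.
have pV x : x \in V -> p x = x by move=> xV; apply: kP.
have pW : {in W, forall x, p x = 0} by move=> x xW; rewrite /p /= gW // linear0.
have pc : p c = c by apply: pV; exact: CV.
(* If p x were outside V, some nonzero element of W would be y + a p x with y in V, which is p z for
   z = y + a x. By [Wker] a multiple of it is c, but c is not in W. *)
have pim x : p x \in V.
  apply: contrapT => /negP/Vmax[y yV [a [zW z0]]].
  have [z zE] : exists z, p z = y + a *: p x.
    by exists (y + a *: x); rewrite linearD linearZ pV.
  have [|b bz] := @Wker p pc pW z; first by rewrite zE; exact/eqP.
  by apply: (Wc _ _ bz); rewrite zE -[b *: _]addr0; exact: Wlin.
exists p; split=> // [x|]; first exact: pV.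
exact: Wker.
Qed.

End Extension.

(** * Simple right ideals and their types *)

Section SimpleGenerators.
Variable R : pzRingType.
Implicit Types c d r s : R.

Definition simple_gen c :=
  c <> 0 /\ forall s, c * s <> 0 -> exists t, c * s * t = c.

(* c r |-> d s r is a nonzero homomorphism from c R to d R, hence an isomorphism
   when both are simple. *)
Definition same_type c d :=
  exists2 s, d * s <> 0 & forall r, c * r = 0 -> d * s * r = 0.

Lemma simple_genMr c s : simple_gen c -> c * s <> 0 -> simple_gen (c * s).
Proof.
move=> [_ csimple] cs0; split=> // r csr0.
have [|t ct] := csimple (s * r); first by rewrite mulrA.
by exists (t * s); rewrite mulrA -(mulrA c) ct.
Qed.

(** A nonzero homomorphism from the simple module c R is injective: if c r t = c, then 1 - r t kills
    c, hence d s, and d s r = 0 would give d s = 0. *)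
Lemma same_type_ann c d : simple_gen c -> simple_gen d -> same_type c d ->
  exists s, [/\ d * s <> 0, forall r, c * r = 0 <-> d * s * r = 0 &
    exists t, d * s * t = d].
Proof.
move=> [c0 cs] [d0 ds] [s ds0 cds]; exists s; split; [by []| |exact: ds].
move=> r; split; first exact: cds.
move=> dsr; apply: contrapT => /cs[t ct]; apply: ds0.
have : c * (1 - r * t) = 0 by rewrite mulrBr mulr1 mulrA ct subrr.
by move/cds/eqP; rewrite mulrBr mulr1 !mulrA dsr mul0r subr0 => /eqP.
Qed.

Lemma same_type_refl c : simple_gen c -> same_type c c.
Proof. by move=> [c0 _]; exists 1; rewrite mulr1. Qed.

Lemma same_type_sym c d : simple_gen c -> simple_gen d -> same_type c d ->
  same_type d c.
Proof.
move=> cs ds /(same_type_ann cs ds)[s [ds0 cds [t dst]]].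
exists t => [ct0|r dr].
  by have [d0 _] := ds; apply: d0; rewrite -dst; apply/cds.
by rewrite -mulrA; apply/cds; rewrite mulrA dst.
Qed.

Lemma same_type_trans c d e : simple_gen d -> simple_gen e ->
  same_type c d -> same_type d e -> same_type c e.
Proof.
move=> ds es [s ds0 cds] /(same_type_ann ds es)[t [et0 det _]].
exists (t * s) => [|r /cds].
  by move=> ets; apply: ds0; apply/det; rewrite -mulrA.
by rewrite -mulrA => /det; rewrite !mulrA.
Qed.

Lemma same_type_mulr c s : simple_gen c -> c * s <> 0 -> same_type c (c * s).
Proof.
move=> [c0 cs] /cs[t cst]; exists t; first by rewrite cst.
by move=> r; rewrite cst.
Qed.

Lemma simple_genMl a c : simple_gen c -> a * c <> 0 ->
  simple_gen (a * c) /\ same_type c (a * c).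
Proof.
move=> cs ac0; split; last first.
  by exists 1; rewrite mulr1 // => r cr; rewrite -mulrA cr mulr0.
split=> // r acr; have [_ /(_ r)[|t crt]] := cs.
  by move=> cr; apply: acr; rewrite -mulrA cr mulr0.
by exists t; rewrite -2!mulrA (mulrA c) crt.
Qed.

Inductive sums (Q : R -> Prop) : R -> Prop :=
| sums0 : sums Q 0
| sumsD x y : Q x -> sums Q y -> sums Q (x + y).

Lemma sums_add Q x y : sums Q x -> sums Q y -> sums Q (x + y).
Proof.
by elim=> [|z {}x Qz _ IH] Ky; rewrite ?add0r // -addrA; apply: sumsD => //; exact: IH.
Qed.

Lemma sums1 Q x : Q x -> sums Q x.
Proof. by move=> Qx; rewrite -[x]addr0; apply: sumsD => //; exact: sums0. Qed.

Lemma sums_mulr (Q : R -> Prop) x s : (forall y, Q y -> y * s <> 0 -> Q (y * s)) ->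
  sums Q x -> sums Q (x * s).
Proof.
move=> QM; elim=> [|z {}x Qz _ IH]; first by rewrite mul0r; exact: sums0.
rewrite mulrDl; have [->|/eqP zs] := eqVneq (z * s) 0; first by rewrite add0r.
by apply: sumsD => //; exact: QM.
Qed.

(** Induction on the sum a + x, for all its multiples. If some r kills a s but not (a + x) s, only x
    contributes to the multiple. Otherwise (a + x) s R is a nonzero image of a s R, so it is simple
    of the type of a. *)
Lemma sums_simple (Q : R -> Prop) x :
  (forall y, Q y -> simple_gen y) ->
  (forall y s, Q y -> y * s <> 0 -> Q (y * s)) ->
  sums Q x -> x <> 0 ->
  exists t, simple_gen (x * t) /\ exists2 a, Q a & same_type a (x * t).
Proof.
move=> Qs QM Kx x0.
suff /(_ 1) : forall s, x * s <> 0 -> exists t, simple_gen (x * (s * t)) /\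
    exists2 a, Q a & same_type a (x * (s * t)).
  by rewrite mulr1 => /(_ x0)[t]; rewrite mul1r => ?; exists t.
elim: Kx {x0} => [s|a {}x Qa _ IH s axs]; first by rewrite mul0r.
have [_ asimple] := Qs a Qa.
have [[r [asr axsr]]|nr] := pselect
  (exists r, a * (s * r) = 0 /\ (a + x) * (s * r) <> 0).
  rewrite mulrDl asr add0r in axsr; have [t xt] := IH _ axsr.
  exists (r * t); rewrite (_ : _ * _ = x * (s * r * t)) //.
  by rewrite (mulrA s) mulrDl (mulrA a) asr mul0r add0r.
have {}nr r : a * (s * r) = 0 -> (a + x) * s * r = 0.
  by move=> asr; apply: contrapT => axsr; apply: nr; exists r; rewrite [(a + x) * _]mulrA.
have as0 : a * s <> 0.
  by move=> as0; apply: axs; rewrite -[LHS]mulr1 nr // mulr1.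
have as1 u : a * (s * u) = a * s -> (a + x) * s * u = (a + x) * s.
  move=> asu; apply/eqP; rewrite -subr_eq0 -{2}[(a + x) * s]mulr1 -mulrBr.
  by apply/eqP/nr; rewrite !(mulrA, mulrBr) mulr1 -(mulrA a) asu subrr.
have [t0 ast0] := asimple s as0.
exists 1; rewrite mulr1; split; last first.
  exists a => //; exists t0 => [axt0|r ar].
    by apply: axs; rewrite -(as1 (t0 * s)) 1?mulrA ?axt0 ?mul0r // !mulrA ast0.
  by rewrite -mulrA; apply: nr; rewrite !mulrA ast0.
split=> // u axsu; have [|t asut] := asimple (s * u).
  by move=> asu; apply: axsu; exact: nr.
by exists (t * s); rewrite -mulrA as1 // !mulrA -(mulrA a) asut.
Qed.

End SimpleGenerators.

(** * Maximal right ideals *)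

Definition max_right_ideal (R : pzRingType) (M : {pred right_regular R}) :=
  [/\ submod_closed M, (1 : R) \notin M &
      forall x : R, x \notin M -> exists s : R, 1 - x * s \in M].

Lemma max_right_ideal_above (R : pzRingType) (B : {pred right_regular R}) :
  submod_closed B -> (1 : R) \notin B ->
  exists M : {pred right_regular R}, max_right_ideal M /\ {subset B <= M}.
Proof.
move=> cB B1; have [|M [cM BM M1 Mmax]] :=
  @max_submod_avoiding _ (right_regular R) B (fun x => x = 1 :> R) cB.
  by move=> x xB x1; move: B1; rewrite -x1 xB.
exists M; split=> //; split=> //; first by apply/negP => /M1.
move=> x /Mmax[y yM [s yxs]]; exists s.
have {}yxs : (y : R) + x * (s : R) = 1 := yxs.
by rewrite -yxs addrK.
Qed.

Lemma maximal_submod_right_ideal (R : pzRingType) (M : {pred right_regular R}) :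
  maximal_submod M -> max_right_ideal M.
Proof.
move=> [cM [z zM] Mmax]; have [M0 Mlin] := cM; split=> //.
  apply: contra zM => M1; have := Mlin z (1 : R) 0 M1 M0.
  by rewrite addr0 -[_ *: _]/((1 : R) * (z : R)) mul1r.
move=> x xM; pose B : {pred right_regular R} := fun y =>
  `[< exists2 m : R, m \in M & exists s : R, y = m + x * s >].
have [|y yM||BT] := Mmax B.
- split=> [|a y y' /asboolP[m mM [s ->]] /asboolP[m' mM' [s' ->]]]; apply/asboolP.
    by exists 0 => //; exists 0; rewrite mulr0 addr0.
  exists (m * a + m'); first exact: (Mlin a m m').
  exists (s * a + s'); rewrite -[a *: _]/((m + x * s) * (a : R)).
  by rewrite mulrDl mulrDr mulrA addrACA.
- by apply/asboolP; exists y => //; exists 0; rewrite mulr0 addr0.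
- move=> BM; case/negP: xM; apply: BM; apply/asboolP.
  by exists 0 => //; exists 1; rewrite mulr1 add0r.
- have /asboolP[m mM [s ms]] := BT 1.
  by exists s; rewrite [X in X - _]ms addrK.
Qed.

(** * Quotients by two-sided ideals and the Jacobson radical *)

Section QuotRingMorphism.
Local Open Scope quotient_scope.
Variables (R : pzRingType) (I : twoSidedIdeal R).
Local Notation Q := (quot_ring I).

Definition quot_proj (x : R) : Q := \pi_Q x.

Lemma quot_proj0 : quot_proj 0 = 0.
Proof. by rewrite /quot_proj !piE. Qed.

Lemma quot_proj1 : quot_proj 1 = 1.
Proof. by rewrite /quot_proj !piE. Qed.

Lemma quot_projB x y : quot_proj (x - y) = quot_proj x - quot_proj y.
Proof. by rewrite /quot_proj !piE. Qed.

Lemma quot_projM x y : quot_proj (x * y) = quot_proj x * quot_proj y.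
Proof. by rewrite /quot_proj !piE. Qed.

Lemma quot_proj_surj (y : Q) : exists x, y = quot_proj x.
Proof. by exists (repr y); rewrite /quot_proj reprK. Qed.

Lemma quot_proj_eq0 x : quot_proj x = 0 <-> x \in I.
Proof.
rewrite -[x in x \in I]subr0 Quotient.idealrBE -/(quot_proj x) -/(quot_proj 0).
by rewrite quot_proj0; split=> [/eqP|/eqP].
Qed.

End QuotRingMorphism.

Section QuotIdeal.
Variables (R : pzRingType) (Z : twoSidedIdeal R) (P : R -> Prop).
Hypotheses (P0 : P 0) (PB : forall x y, P x -> P y -> P (x - y)).
Hypotheses (Pl : forall a x, P x -> P (a * x))
           (Pr : forall a x, P x -> P (x * a)).

Local Notation T := (quot_ring Z).

Definition quot_ideal : {pred T} :=
  let _ := (P0, PB, Pl, Pr) in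
  fun y => `[< exists2 x, P x & y = quot_proj Z x >].

Lemma quot_ideal_zmod : zmod_closed quot_ideal.
Proof.
split=> [|_ _ /asboolP[x Px ->] /asboolP[y Py ->]]; apply/asboolP.
  by exists 0; rewrite // quot_proj0.
by exists (x - y); [exact: PB|rewrite quot_projB].
Qed.

Lemma quot_ideal_mull a : {in quot_ideal, forall u, a * u \in quot_ideal}.
Proof.
move=> _ /asboolP[x Px ->]; apply/asboolP; have [b ->] := quot_proj_surj a.
by exists (b * x); [exact: Pl|rewrite quot_projM].
Qed.

Lemma quot_ideal_mulr a : {in quot_ideal, forall u, u * a \in quot_ideal}.
Proof.
move=> _ /asboolP[x Px ->]; apply/asboolP; have [b ->] := quot_proj_surj a.
by exists (x * b); [exact: Pr|rewrite quot_projM].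
Qed.

HB.instance Definition _ := GRing.isZmodClosed.Build T quot_ideal quot_ideal_zmod.
HB.instance Definition _ := isTwoSided.Build T quot_ideal
  quot_ideal_mull quot_ideal_mulr.

(** As P contains Z, the quotient of R/Z by the image of P is R/P. There r is not nilpotent, so some
    maximal right ideal avoids it; this ideal is pulled back to R. *)
Lemma max_right_ideal_above_nil r : completely_nil_jacobson T ->
  (forall x, x \in Z -> P x) -> (forall n, ~ P (r ^+ n)) ->
  exists M : {pred right_regular R},
    [/\ max_right_ideal M, forall x, P x -> x \in M & r \notin M].
Proof.
move=> hnil ZP rP.
pose U := quot_ring (quot_ideal : twoSidedIdeal T).
pose q (x : R) : U := quot_proj quot_ideal (quot_proj Z x).
have qP x : q x = 0 <-> P x.
  rewrite /q quot_proj_eq0; split=> [/asboolP[y Py xy]|Px]; last by apply/asboolP; exists x.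
  have : x - y \in Z by apply/quot_proj_eq0; rewrite quot_projB xy subrr.
  move=> /ZP Pxy; have PNy : P (- y) by rewrite -[- y]add0r; exact: PB.
  by move: (PB Pxy PNy); rewrite opprK subrK.
have q0 : q 0 = 0 by rewrite /q !quot_proj0.
have q1 : q 1 = 1 by rewrite /q !quot_proj1.
have qB x y : q (x - y) = q x - q y by rewrite /q !quot_projB.
have qD x y : q (x + y) = q x + q y.
  by rewrite -{1}[y]opprK -[- y]add0r !qB q0 sub0r opprK.
have qM x y : q (x * y) = q x * q y by rewrite /q !quot_projM.
have qX x n : q (x ^+ n) = q x ^+ n.
  by elim: n => [|n IH]; [rewrite !expr0 q1|rewrite !exprS qM IH].
have [M [Mmax Mr]] : exists M : {pred right_regular U}, max_right_ideal M /\ q r \notin M.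
  apply: contrapT => nM; have [|n] := hnil quot_ideal (q r).
    apply/asboolP => A /maximal_submod_right_ideal Amax; apply: contrapT => /negP rA.
    by apply: nM; exists A.
  by rewrite -qX => /qP; exact: rP.
have [[M0 Mlin] M1 Minv] := Mmax.
exists (fun x : R => q x \in M); split=> //.
- split; [split| |].
  + by rewrite unfold_in q0.
  + move=> a x y qx qy; rewrite unfold_in -[a *: x]/((x : R) * (a : R)) qD qM.
    exact: (Mlin (q a) (q x) (q y)).
  + by rewrite unfold_in q1.
  + move=> x /Minv[t]; have [u ->] := quot_proj_surj t.
    have [v ->] := quot_proj_surj u; exists v.
    by rewrite unfold_in qB qM q1.
- by move=> x /qP qx; rewrite unfold_in qx.
Qed.

End QuotIdeal.

(** * Supports and the finiteness of the types *)

Section SimpleTypes.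
Variable R : pzRingType.
Implicit Types c d r s : R.

(** [xget] depends only on the set, so isomorphic simple right ideals get the same representative.
    The default 0 is not reached for a simple c, which lies in its own class. *)
Definition type_rep c : R :=
  xget 0 [set d | simple_gen d /\ same_type c d]%classic.

Definition simple_type : Type :=
  {c : R | `[< simple_gen c /\ type_rep c = c >]}.

HB.instance Definition _ := Choice.on simple_type.

Implicit Types o : simple_type.

Lemma simple_type_gen o : simple_gen (val o).
Proof. by have /asboolP[] := valP o. Qed.

Lemma same_type_rep c d : simple_gen c -> simple_gen d -> same_type c d ->
  type_rep c = type_rep d.
Proof.
move=> cs ds cd; congr (xget _ _); apply/seteqP; split=> e [es ce]; split=> //.
  by apply: same_type_trans ce => //; exact: same_type_sym.
exact: same_type_trans ce.
Qed.

Lemma has_simple_type c : simple_gen c -> exists o, same_type (val o) c.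
Proof.
move=> cs; have [repc_simple crepc] : simple_gen (type_rep c) /\ same_type c (type_rep c).
  rewrite /type_rep; case: xgetP => [d _ //|/(_ c)[]]; split=> //.
  exact: same_type_refl.
have h : `[< simple_gen (type_rep c) /\ type_rep (type_rep c) = type_rep c >].
  by apply/asboolP; split=> //; apply: same_type_rep; rewrite //; exact: same_type_sym.
by exists (exist _ (type_rep c) h); exact: same_type_sym.
Qed.

Lemma simple_type_inj o o' : same_type (val o) (val o') -> o = o'.
Proof.
move=> oo'; have /asboolP[os oE] := valP o; have /asboolP[os' oE'] := valP o'.
by apply: val_inj; rewrite -oE -oE'; exact: same_type_rep.
Qed.

Lemma simple_type_uniq o o' c : simple_gen c ->
  same_type (val o) c -> same_type (val o') c -> o = o'.
Proof.
move=> cs oc o'c; apply: simple_type_inj.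
apply: (same_type_trans cs (simple_type_gen o') oc).
exact: (same_type_sym (simple_type_gen o') cs o'c).
Qed.

Definition type_supp r : set simple_type :=
  [set o | exists d, [/\ simple_gen d, same_type (val o) d & r * d <> 0]]%classic.

Local Open Scope classical_set_scope.

Lemma type_supp0 : type_supp 0 = set0.
Proof. by rewrite -subset0 => o [d [_ _]]; rewrite mul0r. Qed.

Lemma type_suppB r s : type_supp (r - s) `<=` type_supp r `|` type_supp s.
Proof.
move=> o [d [ds od rsd]]; have [rd|rd] := pselect (r * d = 0); last by left; exists d.
right; exists d; split=> // sd; apply: rsd.
by rewrite mulrBl rd sd subrr.
Qed.

Lemma type_suppMl r s : type_supp (r * s) `<=` type_supp s.
Proof.
move=> o [d [ds od rsd]]; exists d; split=> // sd; apply: rsd.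
by rewrite -mulrA sd mulr0.
Qed.

(** If r s d is nonzero, then s d generates a simple right ideal of the type of d. With the
    preceding lemmas, the elements whose support lies in an ideal of sets form a two-sided ideal. *)
Lemma type_suppMr r s : type_supp (r * s) `<=` type_supp r.
Proof.
move=> o [d [ds od rsd]]; have [|sds dsd] := @simple_genMl R s d ds.
  by move=> sd; apply: rsd; rewrite -mulrA sd mulr0.
exists (s * d); split; rewrite ?mulrA //.
exact: (same_type_trans ds sds od dsd).
Qed.

(** An essential right annihilator meets the simple right ideal d R, hence contains d. So each ideal
    N_I contains the singular ideal. *)
Lemma type_supp_singular z : z \in right_singular R -> type_supp z = set0.
Proof.
move=> /asboolP ez; rewrite -subset0 => o [d [ds od zd]].
have [d0 dsimple] := ds; apply: d0.
apply: (ez _ (cyclic_submod_closed (d : right_regular R))).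
- move=> y /eqP zy /asboolP[b yE]; apply: contrapT => y0; apply: zd.
  have {}yE : y = d * (b : R) := yE.
  rewrite yE in y0 zy; have [t dbt] := dsimple _ y0.
  by rewrite -dbt mulrA zy mul0r.
- by apply/asboolP; exists (1 : R); rewrite -[_ *: _]/(d * 1) mulr1.
Qed.

End SimpleTypes.

(** * Simple right ideals from the cogenerator property, supports from tightness *)

Section TightRing.
Variable R : pzRingType.
Hypothesis hcog : cogenerator (right_regular R).

(** Some homomorphism from R/B to R does not kill the projection of R onto R/B. The composite is
    left multiplication by d, the image of 1. *)
Lemma left_annihilated (B : {pred right_regular R}) :
  submod_closed B -> (1 : R) \notin B ->
  exists2 d : R, d <> 0 & forall x : R, x \in B -> d * x = 0.
Proof.
move=> cB B1; pose f : {linear right_regular R -> quot_mod cB} := quot_pi cB.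
have [|h hf] := @hcog _ _ f (\0 : {linear right_regular R -> quot_mod cB}).
  move=> /(_ (1 : R))/eqP; rewrite quot_pi_eq0; exact/negP.
have hE (x : R) : h (f x) = (h (f (1 : R)) : R) * x.
  rewrite -[RHS]/((x : R^c) *: h (f (1 : R))) -!linearZ.
  by congr (h (f _)); rewrite -[RHS]/((1 : R) * x) mul1r.
exists (h (f (1 : R))) => [h0|x xB].
  by apply: hf => x; rewrite /= hE h0 mul0r linear0.
by rewrite -hE; have /eqP-> : f x == 0; rewrite ?quot_pi_eq0 ?linear0.
Qed.

(** The right annihilator of d is proper and contains M, so it equals M: every simple module R/M is
    isomorphic to a right ideal d R. *)
Lemma max_right_ideal_annihilator (M : {pred right_regular R}) :
  max_right_ideal M ->
  exists2 d : R, simple_gen d & forall x : R, d * x = 0 <-> x \in M.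
Proof.
move=> [cM M1 Minv]; have [d d0 dM] := left_annihilated cM M1.
have dMx (x : R) : d * x = 0 <-> x \in M.
  split=> [dx|]; last exact: dM.
  apply: contrapT => /negP/Minv[s /dM]; rewrite mulrBr mulr1 mulrA dx mul0r subr0.
  exact: d0.
exists d => //; split=> // s ds.
have /Minv[t /dM] : (s : right_regular R) \notin M by apply/negP => /dMx.
by rewrite mulrBr mulr1 mulrA => /eqP; rewrite subr_eq0 => /eqP; exists t.
Qed.

Variables (E : lmodType R^c) (i : {linear right_regular R -> E}).
Hypotheses (iinj : injective i) (injE : injective_module E).
Hypothesis tightE : forall x : E, embeds (cyclic_submod x) (right_regular R).

Lemma tight_annihilator (y : E) :
  exists r : R, forall s : R, (s : R^c) *: y = 0 <-> r * s = 0.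
Proof.
have [f flin finj] := tightE y.
have C0 : 0 \in cyclic_submod y by apply/asboolP; exists 0; rewrite scale0r.
have Cs (s : R) : (s : R^c) *: y \in cyclic_submod y by apply/asboolP; exists s.
have Cy : y \in cyclic_submod y by apply/asboolP; exists 1; rewrite scale1r.
have f0 : f 0 = 0.
  have := flin 1 0 0 C0 C0; rewrite !scale1r addr0 => /esym/eqP.
  by rewrite -subr_eq0 addrK => /eqP.
have fs (s : R) : f ((s : R^c) *: y) = (f y : R) * s.
  by have := flin (s : R^c) y 0 Cy C0; rewrite f0 !addr0.
exists (f y) => s; rewrite -fs; split=> [->//|fsy].
by apply: finj; rewrite ?f0.
Qed.

Lemma lin_mulr (x s : R) : i (x * s) = (s : R^c) *: i x.
Proof. by rewrite -linearZ. Qed.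

Lemma exists_type_supp (A : set (simple_type R)) : exists r : R,
  forall (o : simple_type R) (d : R), simple_gen d -> same_type (val o) d ->
    r * d <> 0 <-> A o.
Proof.
pose Q (B : set (simple_type R)) (d : R) :=
  simple_gen d /\ exists2 o, B o & same_type (val o) d.
have Qs B d : Q B d -> simple_gen d by case.
have QM B d s : Q B d -> d * s <> 0 -> Q B (d * s).
  move=> [ds [o Bo od]] ds0; have dss := simple_genMr ds ds0; split=> //.
  by exists o => //; apply: (same_type_trans ds dss od); exact: same_type_mulr.
pose K B : {pred right_regular R} := fun x => `[< sums (Q B) x >].
have cK B : submod_closed (K B).
  split=> [|a x y /asboolP Kx /asboolP Ky]; apply/asboolP; first exact: sums0.
  by apply: sums_add => //; apply: sums_mulr Kx => z; exact: QM.
(* A nonzero common x has a simple multiple x s of a type in A, and a further multiple of a type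
   outside A, although x s and its nonzero multiples have the same type. *)
have KAB (x : R) : sums (Q A) x -> sums (Q (~` A)%classic) x -> x = 0.
  move=> KA KB; apply: contrapT => x0.
  have [s [xs [a [as_ [o Ao oa]] axs]]] := sums_simple (@Qs _) (@QM _) KA x0.
  have xs0 := xs.1.
  have KBs : sums (Q (~` A)%classic) (x * s).
    by apply: sums_mulr KB => z; exact: QM.
  have [t [xst [b [bs [o' Ao' ob]] bxst]]] := sums_simple (@Qs _) (@QM _) KBs xs0.
  apply: Ao'; rewrite -(@simple_type_uniq R o o' (x * s * t)) //.
    apply: (same_type_trans xs xst (same_type_trans as_ xs oa axs)).
    exact: same_type_mulr xst.1.
  exact: (same_type_trans bs xst ob bxst).
have [|g [gA gB]] := linear_projection injE i (cK A) (cK (~` A)%classic).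
  by move=> x /asboolP KA /asboolP KB; exact: KAB.
have gE (x : R) : g x = (x : R^c) *: g (1 : R).
  by rewrite -linearZ; congr (g _); rewrite -[RHS]/((1 : R) * x) mul1r.
have [r rP] := tight_annihilator (g (1 : R)).
exists r => o d ds od; split=> [rd|Ao rd].
  apply: contrapT => nAo; apply: rd; apply/rP; rewrite -gE; apply: gB.
  by apply/asboolP; apply: sums1; split=> //; exists o.
have [d0 _] := ds; apply: d0; apply: iinj; rewrite linear0 -gA.
  by rewrite gE; apply/rP.
by apply/asboolP; apply: sums1; split=> //; exists o.
Qed.

End TightRing.

(** * Finiteness of the set of types, then injective hulls of simple right ideals *)

Section InjectiveHulls.
Variable R : pzRingType.
Hypothesis hcog : cogenerator (right_regular R).
Variables (E : lmodType R^c) (i : {linear right_regular R -> E}).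
Hypotheses (iinj : injective i) (injE : injective_module E).

Section Finite.
Hypothesis tightE : forall x : E, embeds (cyclic_submod x) (right_regular R).
Hypothesis hnil : completely_nil_jacobson (quot_ring (right_singular R)).

Lemma finite_simple_type : finite_set [set: simple_type R].
Proof.
apply: contrapT => /ideal_diagonal[I [I0 Isub IU Idiag]].
pose G (o : simple_type R) (A : set (simple_type R)) :=
  (forall r, I (type_supp r) -> val o * r = 0) /\
  (exists2 r, (type_supp r `<=` A)%classic & val o * r <> 0).
have [A nIA|o [A [B [[oI [a aA oa]] [_ [b bB ob]] IAB]]]] := Idiag G; last first.
  (* The annihilator of a simple module is prime: as o a s = o, the element a s b does not kill o,
     although its support lies in both A and B, hence in I. *)
  have [_ /(_ a oa)[s oas]] := simple_type_gen o.
  apply: ob; rewrite -oas -2!(mulrA (val o)); apply: oI.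
  apply: Isub IAB => o' oab; split.
    by apply/aA/(@type_suppMr _ _ s)/(@type_suppMr _ _ b).
  by apply: bB; exact: type_suppMl oab.
have [r rA] := exists_type_supp iinj injE tightE A.
have rsupp : (type_supp r `<=` A)%classic.
  by move=> o [d [ds od rd]]; apply/(rA o d).
(* The powers of r kill no simple right ideal of a type in A, so their supports contain A and none
   of them lies in N_I. *)
have rX n o : A o -> simple_gen (r ^+ n * val o) /\ same_type (val o) (r ^+ n * val o).
  have os := simple_type_gen o; move=> Ao; elim: n => [|n [rs ro]].
    by rewrite expr0 mul1r; split=> //; exact: same_type_refl.
  have rr : r * (r ^+ n * val o) <> 0 by apply/(rA o).
  have [rrs rro] := simple_genMl rs rr; rewrite exprS -mulrA; split=> //.
  exact: (same_type_trans rs rrs ro rro).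
pose P x := I (type_supp x).
have P0 : P 0 by rewrite /P type_supp0.
have PB x y : P x -> P y -> P (x - y).
  by move=> Ix Iy; apply: Isub (@type_suppB _ x y) _; exact: IU.
have Pl a x : P x -> P (a * x) by apply: Isub; exact: type_suppMl.
have Pr a x : P x -> P (x * a) by apply: Isub; exact: type_suppMr.
have [|n IrX|M [Mmax MI rM]] := max_right_ideal_above_nil P0 PB Pl Pr hnil (r := r).
- by move=> x /type_supp_singular xZ; rewrite /P xZ.
- apply: nIA; apply: Isub IrX => o Ao; have [[rs _] ro] := rX n o Ao.
  have os := simple_type_gen o.
  by exists (val o); split=> //; exact: same_type_refl.
have [d ds dM] := max_right_ideal_annihilator hcog Mmax.
have [o od] := has_simple_type ds.
have [s [_ ods [t dst]]] := same_type_ann (simple_type_gen o) ds od.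
exists o; split=> [x Ix|].
  apply/ods; rewrite -mulrA; apply/dM/MI; apply: Isub Ix.
  exact: type_suppMl.
(* As d s t = d, the element t r kills [val o] only if r kills d, that is, if r is in M. *)
exists (t * r); first by move=> o' /type_suppMl/rsupp.
by move=> /ods; rewrite mulrA dst => /dM; exact/negP.
Qed.

End Finite.

(** A homomorphism h from E to R which is nonzero on c is injective on the hull p(E), where every
    nonzero element has c as a multiple. Inverting h there yields an idempotent e with e R =
    h(p(E)). The map [rho] records that e R is injective, being a retract of E. *)
Lemma hull_idempotent c : simple_gen c ->
  exists (e c0 : R) (rho : {linear E -> right_regular R}),
    [/\ e * e = e, simple_gen c0 /\ same_type c c0, e * c0 = c0,
        forall x, e * x <> 0 -> exists s, e * x * s = c0 & rho (i e) = e].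
Proof.
move=> cs; have [c0 csimple] := cs.
have ic0 : i c != 0 by apply/eqP => ic; apply: c0; apply: iinj; rewrite ic linear0.
have [|p [pp pc pess]] := simple_hull_projection injE ic0.
  move=> a; rewrite -[a *: _]/((a : R^c) *: i (c : R)) -lin_mulr => /eqP ica0.
  have [|s cas] := csimple (a : R).
    by move=> ca0; apply: ica0; rewrite ca0 linear0.
  by exists s; rewrite -lin_mulr cas.
have [h hc] : exists h : {linear E -> right_regular R}, h (i c) <> 0.
  have [||y|f fE] := @linear_rel_extension _ E injE (right_regular R)
    (fun x y => y = (x : R^c) *: i c).
  - by rewrite scale0r.
  - move=> a x y x' y' -> ->.
    by rewrite -[a *: x + x']/((a : R^c) * (x : R^c) + x') scalerDl scalerA.
  - by rewrite scale0r.
  have [|h hf] := @hcog _ _ f (\0 : {linear right_regular R -> E}).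
    move=> /(_ (1 : R)); rewrite (fE _ _ erefl) scale1r /=.
    exact/eqP.
  exists h => hic; apply: hf => x; rewrite /= (fE _ _ erefl) linear0.
  by rewrite [LHS]linearZ hic; exact: mulr0.
have hinj v : p v = v -> h v = 0 -> v = 0.
  move=> pv hv; apply: contrapT => /eqP; rewrite -{1}pv => /pess[a av].
  by apply: hc; rewrite -av [LHS]linearZ pv hv; exact: mulr0.
have [|||k kE] := @linear_rel_extension _ E injE (right_regular R)
    (fun x y => p y = y /\ x = h y).
- by rewrite !linear0.
- by move=> a x y x' y' [py ->] [py' ->]; rewrite !linearP py py'.
- by move=> y [py /esym]; exact: hinj.
have [k' k'E] := linear_extension injE k iinj.
pose e : R := h (p (k (1 : R))).
have eE (x : R) : e * x = h (p (k x)).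
  rewrite -[LHS]/((x : R^c) *: h (p (k (1 : R)))) -!linearZ.
  by congr (h (p (k _))); rewrite -[LHS]/((1 : R) * x) mul1r.
have eh v : p v = v -> e * h v = h v.
  by move=> pv; rewrite eE (kE (h v) v) // pv.
have chM (r s : R) : (h (i r) : R) * s = h (i (r * s)).
  by rewrite lin_mulr linearZ.
exists e, (h (i c)), (h \o p \o k'); split.
- by rewrite {2}/e eh // pp.
- split; last by exists 1 => [|r cr]; rewrite mulr1 // chM cr !linear0.
  split=> // s; rewrite chM => hs; have [|t cst] := csimple s.
    by move=> cs0; apply: hs; rewrite cs0 !linear0.
  by exists t; rewrite chM cst.
- exact: eh.
- move=> x; rewrite eE => hx.
  have [|a apx] := pess (k x); first by apply/eqP => px; apply: hx; rewrite px linear0.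
  by exists a; rewrite -apx linearZ.
- by rewrite /= k'E (kE e (p (k (1 : R)))) // pp.
Qed.

Section LocalIdempotent.
Variables (e c : R) (rho : {linear E -> right_regular R}).
Hypotheses (ee : e * e = e) (c0 : c <> 0) (ec : e * c = c).
Hypothesis eess : forall x, e * x <> 0 -> exists s, e * x * s = c.
Hypothesis rho_e : rho (i e) = e.

(** The inverse of left multiplication by a on e R extends by injectivity and gives b with b a = e.
    If the idempotent a b were not e, then a b R and (e - a b) R would both contain c, although they
    meet in 0. *)
Lemma corner_right_inverse a : e * a = a -> a * e = a ->
  (forall x, a * x = 0 -> e * x = 0) -> exists b, a * b = e.
Proof.
move=> ea ae aker.
have [|||g gE] := @linear_rel_extension _ E injE (right_regular R)
  (fun x y => exists r : R, x = a * r /\ y = i (e * r)).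
- by exists 0; rewrite !mulr0 linear0.
- move=> s x y x' y' [r [-> ->]] [r' [-> ->]]; exists (r * (s : R) + r').
  by rewrite !mulrDr !mulrA -linearP.
- by move=> y [r [/esym/aker er ->]]; rewrite er linear0.
have ga : rho (g a) = e.
  by rewrite (gE a (i e)) //; exists 1; rewrite !mulr1.
have gM (x : R) : rho (g x) = (rho (g (1 : R)) : R) * x.
  rewrite -[RHS]/((x : R^c) *: rho (g (1 : R))) -!linearZ.
  by congr (rho (g _)); rewrite -[RHS]/((1 : R) * x) mul1r.
pose b := e * (rho (g (1 : R)) : R) * e.
have ba : b * a = e by rewrite /b -mulrA ea -mulrA -gM ga.
have be : b * e = b by rewrite /b -mulrA ee.
exists b; apply: contrapT => abe.
have ab : e * (a * b) <> 0.
  rewrite mulrA ea => ab0; apply: c0; rewrite -ec; apply: aker.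
  by rewrite -ae -ba mulrA ab0 !mul0r.
have abe' : e * (e - a * b) <> 0.
  by rewrite mulrBr ee mulrA ea => /eqP; rewrite subr_eq0 => /eqP/esym.
have [s abs] := eess ab; have [t abt] := eess abe'.
have abab : a * b * (a * b) = a * b by rewrite mulrA -(mulrA a b a) ba ae.
apply: c0; rewrite -abs mulrA ea.
have -> : a * b * s = a * b * c by rewrite -abs (mulrA e) ea mulrA abab.
have abe0 : a * b * (e * (e - a * b)) = 0.
  by rewrite mulrA -(mulrA a b e) be mulrBr -(mulrA a b e) be abab subrr.
by rewrite -abt mulrA abe0 mul0r.
Qed.

(** The quotient of R by this right ideal is the top of e R: its members are the r for which e r R
    is a proper part of e R. *)
Definition corner_max : {pred right_regular R} :=
  fun r => `[< forall t, e * (r : R) * t <> e >].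

(** Closure under addition is the locality of e R e. If u + v = e, either u is injective on e R and
    has a right inverse, or u kills c; then v fixes c, so it is injective and has a right
    inverse. *)
Lemma corner_max_ideal : max_right_ideal corner_max.
Proof.
have e0 : e <> 0 by move=> e0; apply: c0; rewrite -ec e0 mul0r.
have eX (x y : R) : e * x * y = e -> exists b, e * x * y * e * b = e.
  by move=> ->; exists 1; rewrite ee mulr1.
split.
- split=> [|a x y /asboolP ex /asboolP ey]; apply/asboolP.
    by move=> t; rewrite mulr0 mul0r => /esym.
  move=> t; rewrite -[a *: x]/((x : R) * (a : R)) => xay.
  pose u := e * (x : R) * (a : R) * t * e; pose v := e * (y : R) * t * e.
  have {}xay : e * ((x : R) * (a : R) + (y : R)) * t = e := xay.
  have uv : u + v = e by rewrite -ee -{1}xay mulrDr !mulrDl !mulrA.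
  have eu : e * u = u by rewrite /u !mulrA ee.
  have ue : u * e = u by rewrite /u -mulrA ee.
  have ev : e * v = v by rewrite /v !mulrA ee.
  have ve : v * e = v by rewrite /v -mulrA ee.
  have [ku|/existsNP[z /not_implyP[uz ez]]] :=
      pselect (forall z, u * z = 0 -> e * z = 0).
    have [b ub] := corner_right_inverse eu ue ku.
    by apply: (ex ((a : R) * t * e * b)); rewrite !mulrA.
  have uc : u * c = 0.
    by have [s <-] := eess ez; rewrite !mulrA ue uz mul0r.
  have [w vw|b vb] := corner_right_inverse ev ve.
    apply: contrapT => ew; apply: c0; rewrite -ec -uv mulrDl uc add0r.
    by have [s <-] := eess ew; rewrite !mulrA ve vw mul0r.
  by apply: (ey (t * e * b)); rewrite !mulrA.
- by apply/asboolP => /(_ 1); rewrite !mulr1.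
- move=> x /asboolP/existsNP[t /contrapT ext]; exists t; apply/asboolP => u.
  rewrite -[e * _]/(e * (1 - x * t)) mulrBr mulr1 mulrA ext subrr mul0r.
  by move=> /esym.
Qed.

End LocalIdempotent.

Lemma simple_top c : simple_gen c -> exists (e c0 d : R),
    [/\ e * e = e, simple_gen c0 /\ same_type c c0,
        e * c0 = c0 /\ forall x, e * x <> 0 -> exists s, e * x * s = c0,
        simple_gen d & forall x, d * x = 0 <-> forall t, e * x * t <> e].
Proof.
move=> cs; have [e [c0 [rho [ee [c0s cc0] ec0 eess rhoe]]]] := hull_idempotent cs.
have [d ds dM] := max_right_ideal_annihilator hcog
  (corner_max_ideal ee c0s.1 ec0 eess rhoe).
exists e, c0, d; split=> // x; split=> [/dM/asboolP//|ex].
by apply/dM/asboolP.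
Qed.

End InjectiveHulls.

(* c ranges over socle generators of indecomposable injective right ideals e R,
   d over generators of simple right ideals isomorphic to the top of e R. *)
Section Tops.
Variable R : pzRingType.
Variables e c d : simple_type R -> R.
Hypothesis ee : forall o, e o * e o = e o.
Hypothesis cs : forall o, simple_gen (c o) /\ same_type (val o) (c o).
Hypothesis ec : forall o, e o * c o = c o.
Hypothesis eess : forall o x, e o * x <> 0 -> exists s, e o * x * s = c o.
Hypothesis ds : forall o, simple_gen (d o).
Hypothesis dM : forall o x, d o * x = 0 <-> forall t, e o * x * t <> e o.

(** An isomorphism of the tops lifts to a homomorphism from [e o] R onto [e o'] R. It splits, and
    its section embeds [e o'] R in [e o] R, so the socles are isomorphic. *)
Lemma top_inj o o' : same_type (d o) (d o') -> o = o'.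
Proof.
move=> [u du ddu].
have dee : d o * (1 - e o) = 0.
  apply/dM => t; rewrite mulrBr mulr1 ee subrr mul0r => e0.
  by case: (cs o) => -[c0 _] _; apply: c0; rewrite -ec -e0 mul0r.
have due : d o' * (u * e o) <> 0.
  move=> due; apply: du; have := ddu _ dee.
  by rewrite mulrBr mulr1 -mulrA due subr0.
have [t eut] : exists t, e o' * (u * e o) * t = e o'.
  by apply: contrapT => /forallNP h; apply: due; apply/dM.
have [co' oco'] := cs o'; have [co oco] := cs o.
have etc : e o * t * c o' <> 0.
  move=> etc; have [c0 _] := co'; apply: c0; rewrite -ec -eut.
  by rewrite -!mulrA (mulrA (e o)) etc !mulr0.
have [etcs etct] := simple_genMl co' etc.
have [|s ets] := @eess o (t * c o'); first by rewrite mulrA.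
have {}ets : e o * t * c o' * s = c o by rewrite -ets mulrA.
have ets0 : e o * t * c o' * s <> 0 by rewrite ets; case: co.
apply/esym/(@simple_type_uniq _ _ _ (c o)) => //.
apply: (same_type_trans co' co oco').
by apply: (same_type_trans etcs co etct); rewrite -ets; exact: same_type_mulr.
Qed.

Definition trace_sum := sums (fun x => exists o a b, x = a * e o * b).

(** Sending o to the type of the top [d o] is injective, hence onto by finiteness. If the trace
    ideal were proper, it would lie in a maximal right ideal M. But R/M is the top of some [e o] R,
    so it is not killed by R [e o], which M contains. *)
Lemma trace_sum1 : cogenerator (right_regular R) ->
  finite_set [set: simple_type R] -> trace_sum 1.
Proof.
move=> hcog fin.
have [t tP] := choice (fun o => has_simple_type (ds o)).
have tinj : injective t.
  move=> o o' tt'; apply: top_inj; apply: (same_type_trans _ _ _ (tP o')) => //.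
    exact: simple_type_gen.
  rewrite -tt'; apply: same_type_sym => //; exact: simple_type_gen.
have tsurj o : exists o', t o' = o.
  have /finite_seqP[l lE] := fin.
  have ol p : p \in undup l.
    by have : [set: simple_type R]%classic p by []; rewrite lE mem_undup.
  have [|||_ tl] := @uniq_min_size _ (map t (undup l)) (undup l).
  - by rewrite map_inj_uniq ?undup_uniq.
  - by move=> p _; exact: ol.
  - by rewrite size_map.
  by have := ol o; rewrite -tl => /mapP[o' _ ->]; exists o'.
pose X : {pred right_regular R} := fun x => `[< trace_sum x >].
have cX : submod_closed X.
  split=> [|a x y /asboolP Xx /asboolP Xy]; apply/asboolP; first exact: sums0.
  apply: sums_add => //; apply: sums_mulr Xx => _ [o [u [v ->]]] _.
  by exists o, u, (v * (a : R)); rewrite mulrA.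
apply: contrapT => nX1.
have [|M [Mmax XM]] := max_right_ideal_above cX; first exact/asboolP.
have [d' d's d'M] := max_right_ideal_annihilator hcog Mmax.
have [o' o'd'] := has_simple_type d's; have [o to] := tsurj o'.
have [u du ddu] : same_type (d o) d'.
  apply: (same_type_trans _ _ _ o'd') => //; first exact: simple_type_gen.
  by rewrite -to; apply: same_type_sym => //; exact: simple_type_gen.
have dee : d o * (1 - e o) = 0.
  apply/dM => s; rewrite mulrBr mulr1 ee subrr mul0r => e0.
  by case: (cs o) => -[c0 _] _; apply: c0; rewrite -ec -e0 mul0r.
apply: du; have := ddu _ dee; rewrite mulrBr mulr1 -mulrA.
rewrite (_ : d' * (u * e o) = 0) ?subr0 //.
apply/d'M/XM/asboolP/sums1; exists o, u, 1; by rewrite mulr1.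
Qed.

(** With y = 1 this makes the socle essential. Each summand a e b of y costs at most one more
    multiplication, which brings e b x s to the socle generator c of e R. *)
Lemma trace_sum_socle y x : trace_sum y -> x <> 0 ->
  exists2 s, x * s <> 0 & sums (@simple_gen R) (y * (x * s)).
Proof.
move=> Ty; elim: Ty x => [x x0|_ {}y [o [a [b ->]]] _ IH x /IH[s xs0 ys]].
  by exists 1; rewrite ?mulr1 // mul0r; exact: sums0.
have [ebx|/eess[t ebxt]] := pselect (e o * (b * (x * s)) = 0).
  by exists s => //; rewrite mulrDl -2!mulrA ebx mulr0 add0r.
have [co _] := cs o; have [c0 _] := co.
exists (s * t) => [xst|].
  by apply: c0; rewrite -ebxt -!mulrA xst !mulr0.
rewrite mulrDl; apply: sums_add.
  have -> : a * e o * b * (x * (s * t)) = a * c o by rewrite -ebxt !mulrA.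
  have [->|/eqP ac0] := eqVneq (a * c o) 0; first exact: sums0.
  by apply: sums1; have [] := simple_genMl co ac0.
have -> : y * (x * (s * t)) = y * (x * s) * t by rewrite !mulrA.
by apply: sums_mulr ys => z; exact: simple_genMr.
Qed.

(** The socle of e R is c R: a nonzero e z with z simple generates a simple right ideal, which
    contains c and so equals c R. *)
Lemma hull_socle o x : sums (@simple_gen R) x -> exists r, e o * x = c o * r.
Proof.
elim=> [|z {}x zs _ [r exr]]; first by exists 0; rewrite !mulr0.
suff [t ezt] : exists t, e o * z = c o * t by exists (t + r); rewrite !mulrDr ezt exr.
have [ez0|ez0] := pselect (e o * z = 0); first by exists 0; rewrite mulr0.
have [[_ ezs] _] := simple_genMl zs ez0; have [s ezsc] := eess ez0.
have [|t ezst] := ezs s; first by rewrite ezsc; case: (cs o) => -[].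
by exists t; rewrite -ezsc.
Qed.

(** For x in the socle, e b x lies in c R, so the elements a c, one for each summand a e b of y,
    serve as the [v j]. With y = 1 they generate the socle. *)
Lemma trace_sum_socle_fg y : trace_sum y -> exists n (v : 'I_n -> R),
  (forall j, sums (@simple_gen R) (v j)) /\
  forall x, sums (@simple_gen R) x ->
    exists a : 'I_n -> R, y * x = \sum_(j < n) v j * a j.
Proof.
elim=> [|_ {}y [o [a [b ->]]] _ [n [v [vs vy]]]].
  exists 0, (fun=> 0); split=> [_|x _]; first exact: sums0.
  by exists (fun=> 0); rewrite mul0r big_ord0.
pose cons T (h : T) (w : 'I_n -> T) (j : 'I_n.+1) :=
  if unlift ord0 j is Some k then w k else h.
exists n.+1, (cons R (a * c o) v); split=> [j|x xs].
  rewrite /cons; case: unliftP => [k _|_] //.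
  have [->|/eqP ac0] := eqVneq (a * c o) 0; first exact: sums0.
  by apply: sums1; have [] := simple_genMl (cs o).1 ac0.
have [|r ebx] := @hull_socle o (b * x).
  elim: xs => [|z {}x zs _ IH]; first by rewrite mulr0; exact: sums0.
  rewrite mulrDr; apply: sums_add => //.
  have [->|/eqP bz] := eqVneq (b * z) 0; first exact: sums0.
  by apply: sums1; have [] := simple_genMl zs bz.
have [w yw] := vy x xs; exists (cons R r w).
rewrite big_ord_recl mulrDl -2!mulrA ebx mulrA yw /cons unlift_none.
by congr (_ + _); apply: eq_bigr => j _; rewrite liftK.
Qed.

End Tops.

(** * The socle by generators of simple right ideals, and the conclusion *)

Lemma socleE (R : pzRingType) (x : R) :
  (x : right_regular R) \in socle (right_regular R) <-> sums (@simple_gen R) x.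
Proof.
split=> [/asboolP[n [v [vs ->]]]|].
  elim/big_ind: _ => [||j _]; [exact: sums0|by move=> u w; exact: (@sums_add R _ u w)|].
  have [A [cA _ Asimple] vA] := vs j.
  have [->|/eqP v0] := eqVneq (v j) 0; first exact: sums0.
  apply: sums1; split=> // s vs0.
  pose B := cyclic_submod ((v j : R) * s : right_regular R).
  have [A0 Alin] := cA.
  have vAs (r : R) : ((v j : R) * r : right_regular R) \in A.
    by rewrite -[_ * r]addr0; exact: (Alin r (v j) 0).
  have [y /asboolP[a ->]|B0|AB] := Asimple B (cyclic_submod_closed _).
  - by rewrite -[a *: _]/((v j : R) * s * (a : R)) -mulrA.
  - case: vs0; apply: (B0 ((v j : R) * s)).
    by apply/asboolP; exists 1; rewrite scale1r.
  - by have /asboolP[t vt] := AB _ vA; exists t.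
elim=> [|y {}x ys _ /asboolP[n [v [vs xE]]]].
  by apply/asboolP; exists 0, (fun=> 0); split=> [[]//|]; rewrite big_ord0.
have [y0 ysimple] := ys.
apply/asboolP; exists n.+1.
exists (fun j => if unlift ord0 j is Some k then v k else y); split=> [j|]; last first.
  rewrite big_ord_recl unlift_none xE; congr (_ + _).
  by apply: eq_bigr => j _; rewrite liftK.
case: unliftP => [k _|_]; first exact: vs.
have yy : (y : right_regular R) \in cyclic_submod (y : right_regular R).
  by apply/asboolP; exists 1; rewrite scale1r.
exists (cyclic_submod (y : right_regular R)) => //; split.
- exact: cyclic_submod_closed.
- by exists (y : right_regular R) => //; exact/eqP.
move=> B [B0 Blin] By; have [|/existsNP[z /not_implyP[zB z0]]] :=
  pselect (forall z, z \in B -> z = 0); first by left.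
right=> _ /asboolP[r ->]; have /asboolP[s zE] := By _ zB.
have {}zE : z = y * (s : R) := zE.
have [|t yst] := ysimple (s : R); first by rewrite -zE.
have -> : (r : R^c) *: (y : right_regular R) = ((r : R^c) * (t : R^c)) *: z + 0.
  by rewrite addr0 -scalerA zE; congr (_ *: _); rewrite -[RHS]/(y * (s : R) * t) yst.
exact: Blin.
Qed.

Theorem theorem2p5 (R : pzRingType)
  (hcog : cogenerator (right_regular R))
  (htight : right_tight R)
  (hnil : completely_nil_jacobson (quot_ring (right_singular R))) :
  finitely_generated (socle (right_regular R)) /\
  essential (socle (right_regular R)).
Proof.
have [E [i [[iinj injE _] tightE]]] := htight.
have [e eP] := choice (fun o : simple_type R =>
  simple_top hcog iinj injE (simple_type_gen o)).
have [c {}eP] := choice eP; have [d {}eP] := choice eP.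
have ee o : e o * e o = e o by have [] := eP o.
have cs o : simple_gen (c o) /\ same_type (val o) (c o) by have [] := eP o.
have ec o : e o * c o = c o by have [_ _ []] := eP o.
have eess o x : e o * x <> 0 -> exists s, e o * x * s = c o.
  by have [_ _ [_ h] _ _] := eP o; exact: h.
have ds o : simple_gen (d o) by have [] := eP o.
have dM o x : d o * x = 0 <-> forall t, e o * x * t <> e o.
  by have [_ _ _ _ h] := eP o; exact: h.
have T1 : trace_sum e 1.
  apply: (trace_sum1 ee cs ec eess ds dM hcog).
  exact: (finite_simple_type hcog iinj injE tightE hnil).
split.
  have [n [v [vs vsoc]]] := trace_sum_socle_fg cs eess T1.
  exists n, v => x; rewrite socleE; split=> [/vsoc[a]|[a ->]].
    by rewrite mul1r; exists a.
  elim/big_ind: _ => [||j _]; [exact: sums0|by move=> u w; exact: (@sums_add R _ u w)|].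
  by apply: sums_mulr (vs j) => z; exact: simple_genMr.
move=> B [B0 Blin] soc0 x xB; apply: contrapT => x0.
have [s xs0] := trace_sum_socle cs eess T1 x0; rewrite mul1r => /socleE xs.
apply: xs0; apply: soc0 => //.
by rewrite -[_ * s]addr0; exact: (Blin s x 0).
Qed.
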